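(* Let $M=(V,E,T)$ be a triangulation of a closed Riemann surface, with finite vertex set $V$, edge set $E$ and triangle set $T$, together with a discrete metric $l:E\to(0,\infty)$, such that (1) the graph $(V,E)$ is complete, i.e. any two distinct vertices are connected by an edge; (2) $M$ has no boundary, i.e. each edge lies in the boundary of exactly two triangles; (3) the discrete metric $l$ induces angles $\pi/3$ in each triangle. Let $l(\varepsilon)$ be a smooth family of discrete metrics on $M$, with $\varepsilon$ in an open interval around $0$ and $l(0)=l$ (so that for $\varepsilon=0$ all angles in all triangles equal $\pi/3$). Let $\Delta_\varepsilon$ be the cotan-Laplace operator of $(M,l(\varepsilon))$ and let $\Delta'_\varepsilon$ be the local area normalized cotan-Laplace operator of $(M,l(\varepsilon))$. Then: (i) $$\left.\frac{d}{d\varepsilon}\right|_{\varepsilon=0}\log\det{}'\Delta_\varepsilon=0.$$ (ii) If moreover the total area of all triangles with respect to $l(\varepsilon)$ is independent of $\varepsilon$, then $$\left.\frac{d}{d\varepsilon}\right|_{\varepsilon=0}\log\det{}'\Delta'_\varepsilon=0.$$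
   Context: Edges are unordered pairs of distinct vertices and triangles are triples of vertices all of whose pairs are edges; $(V,E,T)$ is a triangulation (in the usual sense) of a closed surface. A discrete metric on $(V,E,T)$ is a function $l:E\to(0,\infty)$, written $l_{ij}=l(i,j)$, such that for each triangle $(i,j,k)\in T$ the strict triangle inequalities $l_{ij}<l_{jk}+l_{ki}$, $l_{jk}<l_{ki}+l_{ij}$, $l_{ki}<l_{ij}+l_{jk}$ hold. Each triangle of $T$ is thereby given the angles and the area of the Euclidean triangle with these side lengths. For an edge $(i,j)\in E$, let $\alpha_{ij},\beta_{ij}$ be the angles opposite to the edge $(i,j)$ in the two triangles containing that edge, and set $w_{ij}=\cot\alpha_{ij}+\cot\beta_{ij}$. Let $A_i$ be one third of the total area of all triangles having $i$ as a vertex. For $f:V\to\mathbb{R}$, the cotan-Laplace operator is $$(\Delta_{\rm cot}f)(i)=\sum_{j:(i,j)\in E}w_{ij}\,(f(i)-f(j)),$$ and the local area normalized cotan-Laplace operator is $$(\Delta'_{\rm cot}f)(i)=A_i^{-1}\sum_{j:(i,j)\in E}w_{ij}\,(f(i)-f(j)).$$ Both are identified with their $|V|\times|V|$ matrices after enumerating the vertices. For such an operator, $\det'$ denotes the product of its nonzero eigenvalues (counted with multiplicity). *)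

(* Defs.v *)
From HB Require Import structures.
From mathcomp Require Import all_boot all_order all_algebra.
From mathcomp Require Import all_classical all_reals all_analysis.
From mathcomp.real_closed Require Import complex.

Set Implicit Arguments.
Unset Strict Implicit.
Unset Printing Implicit Defensive.

Import Order.TTheory GRing.Theory Num.Theory.
Import numFieldNormedType.Exports.

Local Open Scope ring_scope.

(* Edges are 2-element subsets of [V] and triangles 3-element subsets.
   Conditions such as [[set i; j; k] \in T] force [i], [j], [k] to be pairwise
   distinct, since members of [T] have cardinal 3. *)

Section Triangulation.
Variables (V : finType) (E T : {set {set V}}).

Definition simplicial_surface_complex : Prop :=
  (forall e, e \in E -> #|e| = 2%N) /\
  (forall t, t \in T ->
     #|t| = 3%N /\ forall e : {set V}, e \subset t -> #|e| = 2%N -> e \in E).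

(* The link of [v] is the simple cycle [c]: its vertices are the [j] joined to
   [v] by an edge, its edges the pairs [{j, k}] forming a triangle with [v]. *)
Definition link_is_cycle (v : V) : Prop :=
  exists c : seq V,
    [/\ (2 < size c)%N, uniq c,
        forall j, ([set v; j] \in E) = (j \in c) &
        forall j k, ([set v; j; k] \in T) =
          [&& j \in c, k \in c & (k == next c j) || (j == next c k)]].

(* [o i j k] reads: the ordered triple (i, j, k) is a positive orientation of
   the triangle {i, j, k}.  Two triangles sharing the edge {i, j} must induce
   opposite directions on it. *)
Definition orientable : Prop :=
  exists o : V -> V -> V -> bool,
    (forall i j k, [set i; j; k] \in T ->
       o j k i = o i j k /\ o j i k = ~~ o i j k) /\
    (forall i j k m, k != m -> [set i; j; k] \in T -> [set i; j; m] \in T ->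
       o i j m = ~~ o i j k).

(* A Riemann surface is connected and orientable. *)
Definition closed_Riemann_surface_triangulation : Prop :=
  [/\ simplicial_surface_complex,
      (0 < #|V|)%N,
      forall i j : V, connect [rel a b | [set a; b] \in E] i j,
      forall v, link_is_cycle v &
      orientable].

Definition complete_graph : Prop :=
  forall i j : V, i != j -> [set i; j] \in E.

Definition no_boundary : Prop :=
  forall e, e \in E -> #|[set t in T | e \subset t]| = 2%N.

End Triangulation.

Section CotanLaplace.
Variables (R : realType) (V : finType) (E T : {set {set V}}).

(* Only the values of [l] on [E] are relevant; all definitions below read [l]
   on edges only. *)
Implicit Type l : {set V} -> R.

Definition discrete_metric l : Prop :=
  (forall e, e \in E -> 0 < l e) /\
  (forall i j k, [set i; j; k] \in T ->
     [/\ l [set i; j] < l [set j; k] + l [set k; i],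
         l [set j; k] < l [set k; i] + l [set i; j] &
         l [set k; i] < l [set i; j] + l [set j; k]]).

(* Angle at [k] in the triangle {i, j, k}, i.e. opposite to {i, j}, by the law
   of cosines. *)
Definition angle l (i j k : V) : R :=
  acos ((l [set k; i] ^+ 2 + l [set k; j] ^+ 2 - l [set i; j] ^+ 2)
        / (2 * l [set k; i] * l [set k; j])).

(* Heron's formula. *)
Definition area l (t : {set V}) : R :=
  let s := (\sum_(e in E | e \subset t) l e) / 2 in
  Num.sqrt (s * \prod_(e in E | e \subset t) (s - l e)).

Definition total_area l : R := \sum_(t in T) area l t.

Definition vertex_area l (i : V) : R :=
  (\sum_(t in T | i \in t) area l t) / 3.

Definition cot (x : R) : R := cos x / sin x.

(* For an edge {i, j} the sum has two terms, one for each of the two triangles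
   {i, j, k} containing it. *)
Definition cot_weight l (i j : V) : R :=
  \sum_(k | [set i; j; k] \in T) cot (angle l i j k).

Definition cot_laplace l (f : V -> R) (i : V) : R :=
  \sum_(j | [set i; j] \in E) cot_weight l i j * (f i - f j).

Definition normalized_cot_laplace l (f : V -> R) (i : V) : R :=
  (vertex_area l i)^-1 * cot_laplace l f i.

(* Matrix of an operator on functions [V -> R], in the basis of indicator
   functions of the enumerated vertices. *)
Definition operator_matrix (D : (V -> R) -> V -> R) : 'M[R]_#|V| :=
  \matrix_(i, j) D (fun v => (v == enum_val j)%:R) (enum_val i).

End CotanLaplace.

Section NonzeroDeterminant.
Variables (R : realType) (n : nat).

(* All complex eigenvalues, each repeated according to its algebraic
   multiplicity. *)
Definition eigenvalues (A : 'M[R]_n) : seq R[i] :=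
  sval (closed_field_poly_normal (char_poly (map_mx (real_complex R) A))).

(* The product is real because the nonreal eigenvalues of a real matrix come in
   conjugate pairs, so taking the real part only changes its type. *)
Definition det' (A : 'M[R]_n) : R :=
  complex.Re (\prod_(z <- eigenvalues A | z != 0) z).

End NonzeroDeterminant.

Section Smoothness.
Variables (R : realType).

Definition smooth_on (I : set R) (f : R -> R) : Prop :=
  forall (n : nat) (x : R), I x -> derivable (derive1n n f) x 1.

End Smoothness.

(* Main.v *)
Require Import Defs.
From HB Require Import structures.
From mathcomp Require Import all_boot all_order all_algebra.
From mathcomp Require Import all_classical all_reals all_analysis.
From mathcomp Require Import perm ring lra.
From mathcomp.real_closed Require Import complex.

(** The matrix [A] of a Laplace operator kills the constants.  Adding to it the
    matrix with all entries [b] moves the corresponding zero eigenvalue to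
    [b n], with [n] the number of vertices, and leaves the other eigenvalues
    alone, so [det' A = det (A + b J) / (b n)] as soon as the right hand side is
    nonzero ([det'_rank1_update]).  This replaces [det'] by a genuine
    determinant, to be differentiated entry by entry.

    When all angles are [pi / 3], all edges have the same length
    ([equiangular_edges_equal]), every weight is [b = 2 cot (pi / 3)], and since
    the graph is complete [A = b (n - J)].  With this choice of [b] the
    perturbed matrix [A + b J] is the scalar matrix [b n], where the derivative
    of the determinant is a multiple of the trace of the derivative
    ([is_derive_det_scalar]).  It remains to see that the trace is stationary.

    The trace of the cotan-Laplace operator is the sum of the cotangents of all
    angles, up to a factor.  At the equilateral triangle all three cotangents
    vary in the same proportion to their angle, and the angle sum is constant;
    in terms of the side lengths, the variation at each angle is
    proportional to [da + db - 2 dc], where [c] is the opposite side, and these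
    cancel ([is_derive_cot_angle], [sum_triples_cancel]).

    For the normalized operator the weights are divided by the local areas
    [A_i].  Each vertex lies in [n - 1] triangles of the same area, so all [A_i]
    agree at the start, and the variation of the trace has the additional term
    proportional to the sum of the variations of the [A_i], which is the
    variation of the total area. *)

Import Order.TTheory GRing.Theory Num.Theory.
Import numFieldNormedType.Exports.
Local Open Scope ring_scope.

(** * Rank one updates and the product of the nonzero eigenvalues *)

(** Write [U], [W] for [u], [v] as polynomial matrices and let [B] be the block
    matrix with rows [(1, W)] and [(U, X - A)].  Clearing the lower left block
    by rows gives [det B = char_poly (A + u v)].  Clearing it by columns, after
    scaling the first column by [X], uses [(X - A) U = X U] and gives
    [X det B = (X - v u) char_poly A]. *)
Lemma char_poly_rank1_update (F : comNzRingType) (n : nat) (A : 'M[F]_n)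
    (u : 'cV[F]_n) (v : 'rV[F]_n) : A *m u = 0 ->
  'X * char_poly (A + u *m v) = ('X - ((v *m u) 0 0)%:P) * char_poly A.
Proof.
move=> Au0.
pose U := map_mx polyC u; pose W := map_mx polyC v.
pose B : 'M[{poly F}]_(1 + n) := block_mx 1%:M W U (char_poly_mx A).
have detB : \det B = char_poly (A + u *m v).
  have : block_mx 1%:M 0 (- U) 1%:M *m B
       = block_mx 1%:M W 0 (char_poly_mx (A + u *m v)).
    rewrite mulmx_block !mul1mx !mul0mx !addr0 mulmx1 addNr mulNmx; congr block_mx.
    by rewrite /char_poly_mx map_mxD map_mxM opprD [RHS]addrA; exact: addrC.
  by move/(congr1 determinant); rewrite det_mulmx det_lblock det_ublock !det1 !mul1r.
have AU0 : map_mx polyC A *m U = 0 by rewrite -map_mxM Au0 map_mx0.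
have : B *m block_mx ('X)%:M 0 (- U) 1%:M
     = block_mx ('X - ((v *m u) 0 0)%:P)%:M W 0 (char_poly_mx A).
  rewrite mulmx_block !mulmx0 !mulmx1 !add0r mul1mx; congr block_mx.
    rewrite mulmxN -map_mxM raddfB /=; congr (_ - _).
    by apply/matrixP=> i j; rewrite !ord1 !mxE eqxx mulr1n.
  rewrite mulmxN mulmxBl AU0 subr0 mul_scalar_mx mul_mx_scalar.
  by rewrite subrr.
move/(congr1 determinant); rewrite det_mulmx det_lblock det_ublock !det_scalar1.
by rewrite det1 mulr1 detB mulrC.
Qed.

(** The rank one update moves one zero eigenvalue of [A], the one carried by
    [u], to [v u] and fixes all the others; so if the updated matrix is
    invertible, its determinant is [v u] times the product of the nonzero
    eigenvalues of [A]. *)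
Lemma det'_rank1_update (R : realType) (n : nat) (A : 'M[R]_n)
    (u : 'cV[R]_n) (v : 'rV[R]_n) :
  A *m u = 0 -> (v *m u) 0 0 != 0 -> \det (A + u *m v) != 0 ->
  det' A = \det (A + u *m v) / (v *m u) 0 0.
Proof.
move=> Au0; set c := (v *m u) 0 0; set D := \det _ => c0 D0.
rewrite /det' /eigenvalues.
case: closed_field_poly_normal => r /= pE.
pose f := real_complex R.
have f0 x : (f x == 0) = (x == 0) by rewrite fmorph_eq0.
have updE : 'X * char_poly (map_mx f (A + u *m v))
          = ('X - (f c)%:P) * \prod_(z <- r) ('X - z%:P).
  have := @char_poly_rank1_update _ n (map_mx f A) (map_mx f u) (map_mx f v).
  rewrite -!map_mxM -map_mxD Au0 map_mx0 mxE => -> //.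
  by rewrite pE (monicP (char_poly_monic _)) scale1r.
have r0 : 0 \in r.
  have : root (('X - (f c)%:P) * \prod_(z <- r) ('X - z%:P)) 0.
    by rewrite -updE rootM rootX eqxx.
  by rewrite rootM root_XsubC eq_sym f0 (negPf c0) root_prod_XsubC.
have r_perm := perm_to_rem r0; set r' := rem 0 r in r_perm.
have charE : char_poly (map_mx f (A + u *m v)) = \prod_(z <- f c :: r') ('X - z%:P).
  apply: (mulfI (monic_neq0 (monicX _))).
  by rewrite updE (perm_big _ r_perm) !big_cons subr0 mulrCA.
have size_r' : n = (size r').+1.
  have := congr1 (fun p : {poly _} => size p) charE.
  by rewrite size_char_poly size_prod_XsubC => -[].
have Dprod : f D = f c * \prod_(z <- r') z.
  have := congr1 (fun p : {poly _} => p.[0]) charE.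
  rewrite horner_coef0 char_poly_det det_map_mx big_cons hornerM hornerXsubC.
  rewrite horner_prod (eq_bigr (fun z => - 1 * z)) => [|z _]; last first.
    by rewrite hornerXsubC sub0r mulN1r.
  rewrite big_split /= big_const_seq count_predT iter_mulr_1 sub0r mulNr -mulrN.
  move=> detE; apply: (mulfI (negbT (signr_eq0 _ n))); rewrite detE size_r' exprS.
  by ring.
(* The remaining eigenvalues do not vanish since [D] does not. *)
have r'0 z : z \in r' -> z != 0.
  move=> zr; apply: contra_neq D0 => z0; apply/eqP.
  by rewrite -f0 Dprod mulf_eq0 (big_rem z) //= z0 mul0r eqxx orbT.
suff -> : \prod_(z <- r | z != 0) z = f (D / c) by [].
transitivity (\prod_(z <- r') z); last first.
  have -> : f (D / c) = f D / f c by exact: (fmorph_div (real_complex R)).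
  by rewrite Dprod mulrAC divff ?mul1r // f0.
apply: etrans (perm_big _ r_perm) _; rewrite big_cons eqxx /= big_seq_cond [RHS]big_seq.
by apply: eq_bigl => z; case zr: (z \in r') => //=; exact: r'0.
Qed.

(** * Derivatives of determinants at a scalar matrix *)

Lemma is_derive_bigsum (R : realType) (J : Type) (r : seq J) (P : pred J)
    (f : J -> R -> R) (df : J -> R) (x : R) :
  (forall i, P i -> is_derive x 1 (f i) (df i)) ->
  is_derive x 1 (fun y => \sum_(i <- r | P i) f i y) (\sum_(i <- r | P i) df i).
Proof.
move=> fP; elim: r => [|a r IH].
  rewrite big_nil; under eq_fun do rewrite big_nil; exact: is_derive_cst.
rewrite big_cons; under eq_fun do rewrite big_cons.
by case: ifP => // Pa; have := fP _ Pa => fa; apply: is_deriveD.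
Qed.

Lemma is_derive_bigprod (R : realType) (J : eqType) (r : seq J)
    (f : J -> R -> R) (df : J -> R) (x : R) : uniq r ->
  (forall i, i \in r -> is_derive x 1 (f i) (df i)) ->
  is_derive x 1 (fun y => \prod_(i <- r) f i y)
    (\sum_(i <- r) df i * \prod_(j <- r | j != i) f j x).
Proof.
elim: r => [_ _|a r IH /= /andP[ar ur] fP].
  rewrite big_nil; under eq_fun do rewrite big_nil; exact: is_derive_cst.
under eq_fun do rewrite big_cons.
have fa := fP a (mem_head a r).
have fr := IH ur (fun i ir => fP i (mem_behead (s := a :: r) ir)).
apply: (is_derive_eq (f := f a \* (fun y => \prod_(i <- r) f i y))).
rewrite /= !big_cons eqxx /= addrC; congr (_ + _).
  rewrite /GRing.scale /= mulrC; congr (_ * _); rewrite big_seq_cond [RHS]big_seq_cond.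
  apply: eq_bigl => j; rewrite andbT; case jr: (j \in r) => //=.
  by apply/esym; apply: contraNneq ar => <-.
rewrite /GRing.scale /= mulr_sumr; apply: eq_big_seq => i ir.
have ai : a != i by apply: contraNneq ar => ->.
by rewrite /= big_cons ai mulrCA.
Qed.

(** In the Leibniz formula a permutation other than the identity moves at least
    two indices, so its term has two factors vanishing at [x] and contributes
    nothing to first order. *)
Lemma is_derive_det_scalar (R : realType) (n : nat) (M : R -> 'M[R]_n)
    (N : 'M[R]_n) (a x : R) :
  M x = a%:M -> (forall i j, is_derive x 1 (fun y => M y i j) (N i j)) ->
  is_derive x 1 (fun y => \det (M y)) (a ^+ n.-1 * \tr N).
Proof.
move=> Mx MN.
pose dp (s : 'S_n) := \sum_i N i (s i) * \prod_(j | j != i) M x j (s j).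
have dS : is_derive x 1 (fun y => \det (M y)) (\sum_(s : 'S_n) (-1) ^+ s * dp s).
  apply: is_derive_bigsum => s _.
  have := @is_derive_bigprod _ _ _ (fun i y => M y i (s i)) (fun i => N i (s i)) x
    (index_enum_uniq _) (fun i _ => MN i (s i)) => Ms.
  exact: is_deriveZ.
apply: is_derive_eq dS _; rewrite (bigD1 (1%g : 'S_n)) //= [X in _ + X]big1 ?addr0.
  rewrite odd_perm1 mul1r /dp /mxtrace mulr_sumr; apply: eq_bigr => i _.
  rewrite perm1 mulrC; congr (_ * _).
  rewrite (eq_bigr (fun=> a)) => [|j _]; last by rewrite perm1 Mx mxE eqxx.
  by rewrite prodr_const cardC1 card_ord.
move=> s s1; rewrite /dp big1 ?mulr0 // => i _.
have [j /andP[ji sj]] : exists j, (j != i) && (s j != j).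
  case: (pickP (fun j => (j != i) && (s j != j))) => [j|fixs]; first by exists j.
  case/eqP: s1; apply/permP => j; rewrite perm1.
  have fixj k : k != i -> s k = k.
    by move=> ki; have := fixs k; rewrite ki => /negbFE/eqP.
  have [->|/fixj //] := eqVneq j i.
  apply/eqP; apply: contraT => si; have /perm_inj/eqP := fixj _ si.
  by rewrite (negPf si).
by rewrite (bigD1 j) //= Mx mxE eq_sym (negPf sj) mul0r mulr0.
Qed.

(** At [0] the update of [M] by the constant matrix [b] is the scalar matrix
    [b n], so only the trace of the derivative matters. *)
Lemma is_derive_ln_det' (R : realType) (n : nat) (M : R -> 'M[R]_n)
    (N : 'M[R]_n) (b : R) :
  (0 < n)%N -> 0 < b ->
  (forall y, M y *m const_mx 1 = 0 :> 'cV_n) ->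
  M 0 = (b * n%:R)%:M - const_mx b ->
  (forall i j, is_derive (0 : R) 1 (fun y => M y i j) (N i j)) ->
  \tr N = 0 ->
  is_derive (0 : R) (1 : R) (fun y => ln (det' (M y))) (0 : R).
Proof.
move=> n0 b0 Mker M0 MN trN.
pose u : 'cV[R]_n := const_mx 1; pose v : 'rV[R]_n := const_mx b.
have uv : u *m v = const_mx b.
  by apply/matrixP => i j; rewrite !mxE big_ord1 !mxE mul1r.
have vu : (v *m u) 0 0 = b * n%:R.
  rewrite mxE (eq_bigr (fun=> b)) => [|i _]; last by rewrite !mxE mulr1.
  by rewrite sumr_const card_ord mulr_natr.
have bn0 : 0 < b * n%:R by rewrite mulr_gt0 ?ltr0n.
pose D y := \det (M y + u *m v).
have dD : is_derive (0 : R) 1 D 0.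
  suff: is_derive (0 : R) 1 D ((b * n%:R) ^+ n.-1 * \tr N) by rewrite trN mulr0.
  apply: is_derive_det_scalar => [|i j]; first by rewrite M0 uv subrK.
  under eq_fun do rewrite mxE.
  apply: (is_derive_eq (f := (fun y => M y i j) \+ cst ((u *m v) i j))).
  by rewrite addr0.
have D0 : 0 < D 0 by rewrite /D M0 uv subrK det_scalar exprn_gt0.
have Dcont : {for (0 : R), continuous D}.
  by apply: differentiable_continuous; apply/derivable1_diffP.
apply: (near_eq_is_derive (f := fun y => ln (D y / (b * n%:R)))).
  have : \forall y \near (0 : R), 0 < D y by exact: (cvgr_gt _ Dcont).
  apply: filterS => y Dy.
  by rewrite (@det'_rank1_update _ _ _ u v) ?vu ?gt_eqF.
have dq : is_derive (0 : R) 1 (fun y => D y / (b * n%:R)) 0.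
  apply: (is_derive_eq (f := D \* cst (b * n%:R)^-1)).
  by rewrite !scaler0 addr0.
have dln := is_derive1_ln (divr_gt0 D0 bn0).
have := @is_derive1_comp R (@ln R) (fun y => D y / (b * n%:R)) 0 _ _ dln dq.
by rewrite mulr0.
Qed.

(** For a Laplace operator on the complete graph, constants are always in the
    kernel and the trace is the sum of all weights.  The weights
    need not be symmetric, which allows the area factors of the normalized
    operator to be absorbed in them. *)
Lemma is_derive_ln_det'_laplace (R : realType) (V : finType)
    (w : R -> V -> V -> R) (dw : V -> V -> R) (b : R) :
  (0 < #|V|)%N -> 0 < b ->
  (forall i j, i != j -> w 0 i j = b) ->
  (forall i j, i != j -> is_derive (0 : R) 1 (fun y => w y i j) (dw i j)) ->
  \sum_i \sum_(j | j != i) dw i j = 0 ->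
  is_derive (0 : R) (1 : R)
    (fun y => ln (det' (operator_matrix
      (fun (f : V -> R) i => \sum_(j | j != i) w y i j * (f i - f j))))) (0 : R).
Proof.
move=> V0 b0 w0 dwP sum_dw.
pose N : 'M[R]_#|V| := operator_matrix
  (fun (f : V -> R) i => \sum_(j | j != i) dw i j * (f i - f j)).
apply: (@is_derive_ln_det' _ _ _ N b) => //.
- move=> y; apply/matrixP => i j; rewrite !mxE.
  under eq_bigr do rewrite !mxE mulr1.
  rewrite exchange_big big1 //= => v _; rewrite -mulr_sumr sumrB.
  rewrite (bigD1 i) //= eqxx big1 ?addr0 => [|k ki]; last first.
    by rewrite (inj_eq enum_val_inj) eq_sym (negPf ki).
  rewrite (bigD1 (enum_rank v)) //= enum_rankK eqxx big1 ?addr0 => [|k kv].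
    by rewrite subrr mulr0.
  by rewrite -(inj_eq enum_rank_inj) enum_valK eq_sym (negPf kv).
- apply/matrixP => i j; rewrite !mxE.
  rewrite (eq_bigr (fun v => b * (enum_val i == enum_val j)%:R - b * (v == enum_val j)%:R)).
    2: by move=> v vi; rewrite w0 1?eq_sym // mulrBr.
  rewrite sumrB sumr_const -mulr_sumr (inj_eq enum_val_inj).
  have -> : \sum_(v | v != enum_val i) (v == enum_val j)%:R = (i != j)%:R :> R.
    have [<-|ij] := eqVneq i j; first by apply: big1 => v /negPf ->.
    rewrite (bigD1 (enum_val j)) /=; last by rewrite (inj_eq enum_val_inj) eq_sym.
    by rewrite eqxx big1 ?addr0 // => v /andP[_ /negPf ->].
  have nE : #|V|%:R = #|V|.-1%:R + 1 :> R by rewrite natr1 prednK.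
  rewrite cardC1 nE -mulr_natr; move: (#|V|.-1) => m.
  by case: (i == j) => /=; ring.
- move=> i j; rewrite mxE; under eq_fun do rewrite mxE.
  apply: is_derive_bigsum => v vi.
  have dwv := dwP (enum_val i) v; rewrite eq_sym in dwv; have {}dwv := dwv vi.
  set c := _ - _.
  apply: (is_derive_eq (f := (fun y => w y (enum_val i) v) \* cst c)).
  by rewrite scaler0 add0r /GRing.scale /= mulrC.
- rewrite -[RHS]sum_dw [RHS]big_enum_val /=; apply: eq_bigr => i _.
  rewrite mxE; apply: eq_bigr => v /negPf vi.
  by rewrite eqxx vi subr0 mulr1.
Qed.

(** * Euclidean triangles *)

(** Adding two of the relations gives [b = k (a + c)] and [a = k (b + c)],
    whose difference is [(1 + k) (a - b) = 0]. *)
Lemma equal_cosines_equilateral (R : realFieldType) (a b c k : R) :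
  0 < a -> 0 < b -> 0 < c ->
  a ^+ 2 + b ^+ 2 - c ^+ 2 = 2 * k * a * b ->
  b ^+ 2 + c ^+ 2 - a ^+ 2 = 2 * k * b * c ->
  c ^+ 2 + a ^+ 2 - b ^+ 2 = 2 * k * c * a ->
  a = b.
Proof.
move=> a0 b0 c0 hc ha hb.
have eb : b = k * (a + c).
  have : b * (b - k * (a + c)) = 0 by lra.
  by move/eqP; rewrite mulf_eq0 gt_eqF //= subr_eq0 => /eqP.
have ea : a = k * (b + c).
  have : a * (a - k * (b + c)) = 0 by lra.
  by move/eqP; rewrite mulf_eq0 gt_eqF //= subr_eq0 => /eqP.
have k0 : 0 < k.
  by have : 0 < k * (b + c); [rewrite -ea|rewrite pmulr_lgt0 // addr_gt0].
have : (1 + k) * (a - b) = 0.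
  by lra.
by move/eqP; rewrite mulf_eq0 gt_eqF ?addr_gt0 //= subr_eq0 => /eqP.
Qed.

(** The triangle inequalities put the quotient in the range where [cos] inverts
    [acos]. *)
Lemma law_of_cosines (R : realType) (a b c : R) :
  0 < a -> 0 < b -> c < a + b -> b < c + a -> a < b + c ->
  a ^+ 2 + b ^+ 2 - c ^+ 2
    = 2 * cos (acos ((a ^+ 2 + b ^+ 2 - c ^+ 2) / (2 * a * b))) * a * b.
Proof.
move=> a0 b0 hc hb ha.
have ab0 : 0 < 2 * a * b by rewrite !mulr_gt0.
rewrite acosK; first by field; rewrite !gt_eqF.
rewrite in_itv /= ler_pdivlMr // ler_pdivrMr //.
apply/andP; split.
  have : 0 <= (a + b - c) * (a + b + c) by apply: mulr_ge0; lra.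
  by move=> ?; lra.
have : 0 <= (c + a - b) * (b + c - a) by apply: mulr_ge0; lra.
by move=> ?; lra.
Qed.

Lemma derivable_cot_acos (R : realType) (x : R) : -1 < x < 1 ->
  derivable (fun y : R => cot (acos y)) x 1.
Proof.
move=> x1; have /andP[xgt xlt] := x1.
have sin0 : sin (acos x) != 0.
  by rewrite gt_eqF // sin_gt0_pi // acos_gt0 ?acos_ltpi ?xgt ?xlt ?ltW.
have dcos := is_derive_cos (acos x); have dsin := is_derive_sin (acos x).
have dVsin := is_deriveV sin0 dsin.
have dcot : is_derive (acos x) 1 (@cot R)
   (cos (acos x) *: (- sin (acos x) ^- 2 *: cos (acos x)) +
    (sin (acos x))^-1 *: (- sin (acos x))).
  exact: (@is_deriveM R _ (@cos R) (fun y => (sin y)^-1)).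
have dacos := is_derive1_acos x1.
by have [] := @is_derive1_comp R (@cot R) (@acos R) x _ _ dcot dacos.
Qed.

(** At an equilateral triangle the cosine of an angle varies by the variation
    of the two adjacent sides minus twice that of the opposite side, up to a
    scale; this is the expression that cancels over the three angles. *)
Lemma is_derive_cosine_equilateral (R : realType) (a b c : R -> R) (da db dc s x : R) :
  0 < s -> a x = s -> b x = s -> c x = s ->
  is_derive x 1 a da -> is_derive x 1 b db -> is_derive x 1 c dc ->
  is_derive x 1 (fun y => (a y ^+ 2 + b y ^+ 2 - c y ^+ 2) / (2 * a y * b y))
    ((da + db - 2 * dc) / (2 * s)).
Proof.
move=> s0 ax bx cx dA dB dC.
pose den := (cst 2 \* a) \* b.
have den0 : den x != 0 by rewrite /den /= ax bx gt_eqF // !mulr_gt0.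
have dden : is_derive x 1 den (2 * s * db + s * (2 * da)).
  apply: is_derive_eq; rewrite /= ax bx scaler0 addr0 /GRing.scale /=; ring.
have dV := is_deriveV den0 dden.
apply: (is_derive_eq (f := (a ^+ 2 + b ^+ 2 - c ^+ 2) \* (fun y => (den y)^-1))).
rewrite /den /= !fctE ax bx cx /GRing.scale /=.
by field; rewrite gt_eqF.
Qed.

Lemma cot_pi3_gt0 (R : realType) : 0 < cot (pi / 3 : R).
Proof.
have pi0 := pi_gt0 R.
by rewrite /cot divr_gt0 ?cos_gt0_pihalf ?sin_gt0_pi //; apply/andP; split; lra.
Qed.

(** * Combinatorics of complete triangulations *)

Lemma set3_rot (V : finType) (i j k : V) : [set i; j; k]%SET = [set j; k; i]%SET.
Proof. by apply/setP=> x; rewrite !inE; do 3 case: (x == _). Qed.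

Lemma set3_swap (V : finType) (i j k : V) : [set i; j; k]%SET = [set j; i; k]%SET.
Proof. by apply/setP=> x; rewrite !inE; do 3 case: (x == _). Qed.

Lemma set2_swap (V : finType) (i j : V) : [set i; j]%SET = [set j; i]%SET.
Proof. by apply/setP=> x; rewrite !inE orbC. Qed.

Lemma cards3_neq (V : finType) (i j k : V) :
  #|[set i; j; k]%SET| = 3%N -> [/\ i != j, i != k & j != k].
Proof.
have sub2 (x y : V) : (#|[set x; y]%SET| <= 2)%N by rewrite cards2; case: eqP.
have [<-|ij] := eqVneq i j; first by rewrite finset.setUid => e; have := sub2 i k; rewrite e.
have [<-|ik] := eqVneq i k.
  by rewrite set3_rot -finset.setUA finset.setUid => e; have := sub2 j i; rewrite e.
have [<-|jk] := eqVneq j k; last by [].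
by rewrite -finset.setUA finset.setUid => e; have := sub2 i j; rewrite e.
Qed.

Lemma const_on_cycle (V : eqType) (W : eqType) (f : V -> W) (c : seq V) :
  uniq c -> {in c, forall j, f (next c j) = f j} -> {in c &, forall j k, f j = f k}.
Proof.
move=> uc fc.
have : cycle [rel x y | f y == f x] c.
  have := cycle_next uc; case: c uc fc => // x p uc fc.
  rewrite /cycle; apply: (@sub_in_path _ (mem (x :: p))) => [y z yc zc /= /eqP <-|].
    by rewrite fc.
  by apply/allP => y; rewrite !inE mem_rcons !inE orbA orbb.
case: c uc fc => // x p _ _ xp.
have fx y : y \in x :: p -> f y = f x.
  move=> yp; apply/eqP.
  have := order_path_min (leT := [rel x y | f y == f x]) (x := x) (s := rcons p x).
  move=> /(_ _ xp) /allP; apply; last by rewrite mem_rcons.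
  by move=> ? ? ? /= /eqP <- /eqP ->.
by move=> j k /fx -> /fx ->.
Qed.

Lemma complete_edgeE (V : finType) (E T : {set {set V}}) :
  simplicial_surface_complex E T -> complete_graph E ->
  forall i j : V, ([set i; j]%SET \in E) = (i != j).
Proof.
move=> [E2 _] compl i j; apply/idP/idP => [/E2|/compl //].
by rewrite cards2; case: eqP.
Qed.

Lemma card_triangles_at_edge (V : finType) (E T : {set {set V}}) (i j : V) :
  simplicial_surface_complex E T -> no_boundary E T -> [set i; j]%SET \in E ->
  #|[pred k | [set i; j; k]%SET \in T]| = 2%N.
Proof.
move=> [E2 T3] nob ijE; rewrite -(nob _ ijE).
rewrite -(card_in_imset (f := fun k => [set i; j; k]%SET)); last first.
  move=> k m /= kT mT /setP /(_ k); rewrite !inE eqxx orbT => /esym.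
  have [_ ik jk] := cards3_neq _ _ _ _ (T3 _ kT).1.
  by rewrite [k == i]eq_sym [k == j]eq_sym (negPf ik) (negPf jk) => /eqP.
apply: eq_card => t; rewrite !inE; apply/imsetP/andP => [[k kT ->]|[tT ijt]].
  by split=> //; apply: finset.subsetUl.
have /cards1P[k tk] : #|t :\: [set i; j]%SET|%SET == 1%N.
  by rewrite cardsDS // (T3 t tT).1 (E2 _ ijE).
have tE : t = [set i; j; k]%SET.
  by rewrite -(finset.setID t [set i; j]%SET) tk (finset.setIidPr ijt).
by exists k; rewrite // inE -tE.
Qed.

(** Count the pairs of an edge at [i] and a triangle containing it: each of the
    [n - 1] edges lies in two triangles, and each triangle at [i] has two edges
    at [i]. *)
Lemma card_triangles_at_vertex (V : finType) (E T : {set {set V}}) (i : V) :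
  simplicial_surface_complex E T -> complete_graph E -> no_boundary E T ->
  #|[pred t in T | i \in t]| = #|V|.-1.
Proof.
move=> sc compl nob.
have: (\sum_(t in T | i \in t) \sum_(j | (j != i) && (j \in t)) 1 = #|V|.-1 * 2)%N.
  rewrite (exchange_big_dep (predC1 i)) /=; last by move=> t j _ /andP[].
  rewrite -(cardC1 i) -sum_nat_const; apply: eq_bigr => j ji.
  have ijE : [set i; j]%SET \in E by rewrite compl 1?eq_sym.
  rewrite sum1_card -[RHS](nob _ ijE).
  apply: eq_card => t; rewrite !inE finset.subUset !finset.sub1set.
  by rewrite unfold_in ji /= andbA.
rewrite (eq_bigr (fun=> 2%N)) ?sum_nat_const; last first.
  move=> t /andP[tT it]; have [t3 _] := sc.2 t tT.
  rewrite sum1_card; move: t3; rewrite (cardsD1 i) it => -[<-].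
  by apply: eq_card => j; rewrite !inE.
by move/eqP; rewrite eqn_pmul2r // => /eqP.
Qed.

(** * Equilateral discrete metrics *)

(** Every triangle is equilateral, so along the link cycle of a vertex two
    successive edges at that vertex have the same length; hence all edges at a
    vertex are equally long, and any two edges are joined by a third one. *)
Lemma equiangular_edges_equal (R : realType) (V : finType) (E T : {set {set V}})
    (l : {set V} -> R) (theta : R) :
  closed_Riemann_surface_triangulation E T -> complete_graph E ->
  discrete_metric E T l ->
  (forall i j k : V, [set i; j; k]%SET \in T -> angle l i j k = theta) ->
  exists2 s, 0 < s & forall e, e \in E -> l e = s.
Proof.
move=> [sc V0 _ links _] compl [lpos ltri] ang.
have EE := complete_edgeE _ _ _ sc compl.
have tri i j k : [set i; j; k]%SET \in T -> l [set i; j]%SET = l [set i; k]%SET.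
  move=> tT.
  have lc x y z : [set x; y; z]%SET \in T ->
    l [set x; y]%SET ^+ 2 + l [set y; z]%SET ^+ 2 - l [set z; x]%SET ^+ 2
    = 2 * cos theta * l [set x; y]%SET * l [set y; z]%SET.
    move=> tT'; have [t1 t2 t3] := ltri _ _ _ tT'.
    have [xy xz yz] := cards3_neq _ _ _ _ (sc.2 _ tT').1.
    rewrite -(ang x z y); last by rewrite set3_swap set3_rot.
    rewrite /angle (set2_swap _ y x) (set2_swap _ x z); apply: law_of_cosines;
      by rewrite ?lpos ?EE //; lra.
  have [ij ik jk] := cards3_neq _ _ _ _ (sc.2 _ tT).1.
  rewrite (set2_swap _ i j).
  apply: (@equal_cosines_equilateral _ _ _ (l [set k; j]%SET) (cos theta));
    try by rewrite lpos // EE // eq_sym.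
  - by rewrite lc // set3_swap.
  - by rewrite lc // set3_swap set3_rot.
  - by rewrite lc // set3_swap -set3_rot.
have star i j k : i != j -> i != k -> l [set i; j]%SET = l [set i; k]%SET.
  move=> ij ik; have [c [_ uc cE cT]] := links i.
  have jc : j \in c by rewrite -cE EE.
  have kc : k \in c by rewrite -cE EE.
  apply: (const_on_cycle _ _ (fun x => l [set i; x]%SET) c) => // x xc.
  apply: tri; rewrite cT xc mem_next xc eqxx orbT //.
have [i _] : exists i : V, i \in predT by apply/card_gt0P.
have [c [c2 _ cE _]] := links i.
have [j jc] : exists j, j \in c by case: c c2 {cE} => // j c _; exists j; rewrite inE eqxx.
have ij : i != j by rewrite -EE cE.
exists (l [set i; j]%SET) => [|e eE]; first by apply: lpos; rewrite EE.
have /eqP/cards2P[x [y [xy ->]]] := sc.1 e eE.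
have [xi|xi] := eqVneq x i; first by rewrite xi in xy *; exact: star.
by rewrite (star x y i) // set2_swap; apply: star; rewrite // eq_sym.
Qed.

Lemma area_equilateral (R : realType) (V : finType) (E T : {set {set V}})
    (l : {set V} -> R) (s : R) (t : {set V}) :
  simplicial_surface_complex E T -> (forall e, e \in E -> l e = s) -> t \in T ->
  area E l t = Num.sqrt (s *+ 3 / 2 * (s *+ 3 / 2 - s) ^+ 3).
Proof.
move=> [E2 T3] lE tT.
have e3 : #|[pred e in E | e \subset t]| = 3%N.
  have [t3 tE] := T3 t tT.
  rewrite -[RHS]/('C(3, 2)) -t3 -cards_draws; apply: eq_card => e; rewrite !inE.
  apply/andP/andP => [[eE et]|[et /eqP e2]]; split=> //; last exact: tE.
  by rewrite E2.
rewrite /area (eq_bigr (fun=> s)) => [|e /andP[/lE //]].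
rewrite sumr_const e3 (eq_bigr (fun=> s *+ 3 / 2 - s)) => [|e /andP[/lE -> //]].
by rewrite prodr_const e3.
Qed.

Lemma vertex_area_equilateral (R : realType) (V : finType) (E T : {set {set V}})
    (l : {set V} -> R) (a : R) (i : V) :
  simplicial_surface_complex E T -> complete_graph E -> no_boundary E T ->
  (forall t, t \in T -> area E l t = a) ->
  vertex_area E T l i = a *+ #|V|.-1 / 3.
Proof.
move=> sc compl nob lA.
rewrite /vertex_area (eq_bigr (fun=> a)) => [|t /andP[/lA //]].
by rewrite sumr_const (card_triangles_at_vertex _ E).
Qed.

Lemma vertex_area_sum (R : realType) (V : finType) (E T : {set {set V}}) (l : {set V} -> R) :
  (forall t, t \in T -> #|t| = 3%N) ->
  \sum_i vertex_area E T l i = total_area E T l.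
Proof.
move=> T3; rewrite /vertex_area -mulr_suml.
rewrite (exchange_big_dep (mem T)) /=; last by move=> ? ? _ /andP[].
rewrite mulr_suml; apply: eq_bigr => t tT.
by rewrite tT /= sumr_const T3 // -[_ *+ 3]mulr_natr mulfK // pnatr_eq0.
Qed.

(** Positivity keeps Heron's expression away from the point where the square root
    is not differentiable. *)
Lemma derivable_area (R : realType) (V : finType) (E : {set {set V}})
    (L : R -> {set V} -> R) (t : {set V}) (x : R) :
  (forall e, e \in E -> derivable (fun y => L y e) x 1) -> 0 < area E (L x) t ->
  derivable (fun y => area E (L y) t) x 1.
Proof.
move=> dL; rewrite sqrtr_gt0 => pos.
pose S y : R := (\sum_(e in E | e \subset t) L y e) / 2.
have [dS Sd] : exists dS, is_derive x 1 S dS.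
  have dsum := @is_derive_bigsum R _ (index_enum _) (fun e => (e \in E) && (e \subset t))
    (fun e y => L y e) _ x (fun e He => derivableP (dL e (andP He).1)).
  eexists; exact: (is_deriveM dsum (is_derive_cst (2^-1 : R) x 1)).
have dfac e : e \in enum [pred e in E | e \subset t] ->
    is_derive x 1 (fun y => S y - L y e) (dS - 'D_1 (fun y => L y e) x).
  by rewrite mem_enum => /andP[eE _]; exact: is_deriveB Sd (derivableP (dL e eE)).
have dprod := is_derive_bigprod _ _ _ _ _ _ (enum_uniq _) dfac.
have dheron := is_deriveM Sd dprod.
have areaE y : area E (L y) t
    = Num.sqrt (S y * \prod_(e <- enum [pred e in E | e \subset t]) (S y - L y e)).
  by rewrite big_enum.
under eq_fun do rewrite areaE.
have pos' : 0 < S x * \prod_(e <- enum [pred e in E | e \subset t]) (S x - L x e).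
  by rewrite big_enum.
pose H := S \* (fun y => \prod_(e <- enum [pred e in E | e \subset t]) (S y - L y e)).
by have [] := @is_derive1_comp R (@Num.sqrt R) H x _ _ (is_derive1_sqrt pos') dheron.
Qed.

Lemma is_derive_cot_angle (R : realType) (V : finType) (E T : {set {set V}})
   (L : R -> {set V} -> R) (s x : R) :
  0 < s -> simplicial_surface_complex E T -> 
  (forall e, e \in E -> L x e = s) ->
  (forall e, e \in E -> derivable (fun y => L y e) x 1) ->
  forall i j k, [set i; j; k]%SET \in T ->
  let d i j := 'D_1 (fun y => L y [set i; j]%SET) x in
  is_derive x 1 (fun y => cot (angle (L y) i j k))
    ('D_1 (fun y : R => cot (acos y)) (2^-1) / (2 * s) * (d k i + d j k - d i j *+ 2)).
Proof.
move=> s0 sc Ls dL i j k tT d.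
have [ij ik jk] := cards3_neq _ _ _ _ (sc.2 _ tT).1.
have tE a b : a \in [set i; j; k]%SET -> b \in [set i; j; k]%SET -> a != b -> [set a; b]%SET \in E.
  move=> at_ bt ab; apply: (sc.2 _ tT).2; last by rewrite cards2 ab.
  by rewrite finset.subUset !finset.sub1set at_.
have kiE : [set k; i]%SET \in E by apply: tE; rewrite ?inE ?eqxx ?orbT // eq_sym.
have jkE : [set j; k]%SET \in E by apply: tE; rewrite ?inE ?eqxx ?orbT // eq_sym.
have ijE : [set i; j]%SET \in E by apply: tE; rewrite ?inE ?eqxx ?orbT // eq_sym.
have dr := is_derive_cosine_equilateral _ _ _ _ _ _ _ _ _ s0 (Ls _ kiE) (Ls _ jkE) (Ls _ ijE)
  (derivableP (dL _ kiE)) (derivableP (dL _ jkE)) (derivableP (dL _ ijE)).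
pose ratio y := (L y [set k; i]%SET ^+ 2 + L y [set j; k]%SET ^+ 2 - L y [set i; j]%SET ^+ 2)
  / (2 * L y [set k; i]%SET * L y [set j; k]%SET).
have r2 : ratio x = 2^-1.
  by rewrite /ratio !Ls //; field; rewrite gt_eqF.
have dcot : is_derive (ratio x) 1 (fun y : R => cot (acos y))
    ('D_1 (fun y : R => cot (acos y)) (2^-1)).
  by rewrite r2; apply/derivableP/derivable_cot_acos; lra.
have := @is_derive1_comp R _ ratio x _ _ dcot dr.
rewrite /angle (finset.setUC [set k]%SET [set j]%SET) => dcr.
apply: is_derive_eq dcr _; rewrite -/(d k i) -/(d j k) -/(d i j); field; exact: lt0r_neq0.
Qed.

(** Rotating the triples turns each of the three triple sums of [d] into the
    same one.  With [d] the variation of the edge lengths this is the infinitesimal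
    form of the constant angle sum of a triangle. *)
Lemma sum_triples_cancel (U : zmodType) (V : finType)
    (t : V -> V -> V -> bool) (d : V -> V -> U) :
  (forall i j k, t i j k = t j k i) ->
  \sum_i \sum_j \sum_(k | t i j k) (d k i + d j k - d i j *+ 2) = 0.
Proof.
move=> trot.
pose F i j k := if t i j k then d i j else 0.
have FE : \sum_i \sum_j \sum_(k | t i j k) (d k i + d j k - d i j *+ 2)
   = \sum_i \sum_j \sum_k (F k i j + F j k i - F i j k *+ 2).
  apply: eq_bigr => i _; apply: eq_bigr => j _; rewrite big_mkcond; apply: eq_bigr => k _.
  by rewrite /F (trot k) -(trot i); case: (t i j k); rewrite // add0r mul0rn subr0.
rewrite FE.
have S1 : \sum_i \sum_j \sum_k F k i j = \sum_i \sum_j \sum_k F i j k.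
  under eq_bigr do rewrite exchange_big.
  by rewrite exchange_big.
have S2 : \sum_i \sum_j \sum_k F j k i = \sum_i \sum_j \sum_k F i j k.
  by rewrite exchange_big; under eq_bigr do rewrite exchange_big.
have split3 : \sum_i \sum_j \sum_k (F k i j + F j k i - F i j k *+ 2)
  = \sum_i \sum_j \sum_k F k i j + \sum_i \sum_j \sum_k F j k i
    - (\sum_i \sum_j \sum_k F i j k) *+ 2.
  rewrite -big_split -sumrMnl -sumrB; apply: eq_bigr => i _.
  rewrite -big_split -sumrMnl -sumrB; apply: eq_bigr => j _.
  by rewrite -big_split -sumrMnl -sumrB.
by rewrite split3 S1 S2 -mulr2n subrr.
Qed.

(** * Stationarity of the determinants *)

Theorem theorem5p1 (R : realType) (V : finType) (E T : {set {set V}})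
    (surfM : closed_Riemann_surface_triangulation E T)
    (l : {set V} -> R) (metric_l : discrete_metric E T l)
    (completeM : complete_graph E)
    (no_boundaryM : no_boundary E T)
    (angles_l : forall i j k : V, [set i; j; k]%SET \in T -> angle l i j k = pi / 3)
    (I : set R) (I_interval : is_interval I) (I_open : open I) (I0 : I 0)
    (L : R -> {set V} -> R)
    (metric_L : forall eps : R, I eps -> discrete_metric E T (L eps))
    (smooth_L : forall e : {set V}, e \in E -> smooth_on I (fun eps : R => L eps e))
    (L0 : forall e : {set V}, e \in E -> L 0 e = l e) :
  is_derive (0 : R) (1 : R)
    (fun eps : R => ln (det' (operator_matrix (cot_laplace E T (L eps))))) (0 : R)
  /\
  ((forall eps : R, I eps -> total_area E T (L eps) = total_area E T (L 0)) ->
   is_derive (0 : R) (1 : R)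
     (fun eps : R =>
        ln (det' (operator_matrix (normalized_cot_laplace E T (L eps))))) (0 : R)).
Proof.
have [sc V0 _ links _] := surfM.
have EE := complete_edgeE _ _ _ sc completeM.
have [s s0 ls] := equiangular_edges_equal _ _ _ _ _ _ surfM completeM metric_l angles_l.
have Ls e : e \in E -> L 0 e = s by move=> eE; rewrite L0 // ls.
have dL e : e \in E -> derivable (fun y => L y e) 0 1.
  by move=> eE; exact: (smooth_L e eE 0%N 0 I0).
have T3 t : t \in T -> #|t| = 3%N by move=> /sc.2[].
pose d i j := 'D_1 (fun y => L y [set i; j]%SET) 0.
pose g := 'D_1 (fun y : R => cot (acos y)) (2^-1) / (2 * s).
pose b : R := cot (pi / 3) *+ 2.
have b0 : 0 < b by rewrite mulrn_wgt0 // cot_pi3_gt0.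
(* The variation of the weights, from that of the lengths [d]; [g] collects the
   factors common to all angles at [0]. *)
pose dw i j := \sum_(k | [set i; j; k]%SET \in T) g * (d k i + d j k - d i j *+ 2).
have w0 i j : i != j -> cot_weight T (L 0) i j = b.
  rewrite -EE => ijE; rewrite /cot_weight (eq_bigr (fun=> cot (pi / 3))) => [|k tT].
    by rewrite sumr_const (card_triangles_at_edge _ _ _ _ _ sc).
  have [ij ik jk] := cards3_neq _ _ _ _ (T3 _ tT).
  have lE x y : x != y -> L 0 [set x; y]%SET = l [set x; y]%SET.
    by move=> xy; rewrite L0 // EE.
  by rewrite -(angles_l _ _ _ tT) /angle !lE // eq_sym.
have dwP i j : is_derive (0 : R) 1 (fun y => cot_weight T (L y) i j) (dw i j).
  apply: is_derive_bigsum => k tT.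
  exact: (@is_derive_cot_angle _ _ E T L s 0).
have sum_dw : \sum_i \sum_(j | j != i) dw i j = 0.
  transitivity (g * \sum_i \sum_j \sum_(k | [set i; j; k]%SET \in T)
                      (d k i + d j k - d i j *+ 2)).
    rewrite mulr_sumr; apply: eq_bigr => i _; rewrite mulr_sumr big_mkcond.
    apply: eq_bigr => j _; rewrite mulr_sumr; case: eqP => //= ->.
    by rewrite big1 // => k /T3/cards3_neq[]; rewrite eqxx.
  rewrite (sum_triples_cancel _ _ (fun i j k => [set i; j; k]%SET \in T)) ?mulr0 //.
  by move=> i j k; rewrite set3_rot.
have edge_sum (F : V -> R) i : \sum_(j | [set i; j]%SET \in E) F j = \sum_(j | j != i) F j.
  by apply: eq_bigl => j; rewrite EE eq_sym.
split.
  have := is_derive_ln_det'_laplace _ _ _ _ _ V0 b0 w0 (fun i j _ => dwP i j) sum_dw.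
  apply: near_eq_is_derive; apply: filterE => y; congr (ln (det' (operator_matrix _))).
  by apply/funext => f; apply/funext => i; rewrite /cot_laplace edge_sum.
move=> area_const.
pose a := Num.sqrt (s *+ 3 / 2 * (s *+ 3 / 2 - s) ^+ 3).
have a0 : 0 < a.
  by rewrite sqrtr_gt0 mulr_gt0 ?exprn_gt0 //; lra.
have area0 t : t \in T -> area E (L 0) t = a by exact: area_equilateral.
pose A := a *+ #|V|.-1 / 3.
have vA i : vertex_area E T (L 0) i = A by exact: vertex_area_equilateral.
have A0 : 0 < A.
  rewrite divr_gt0 // pmulrn_lgt0 //.
  have /card_gt0P[i _] := V0; have [c [c2 uc cE _]] := links i.
  rewrite -(cardC1 i); apply/card_gt0P.
  case: c c2 uc cE => // j c _ _ cE; exists j.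
  by rewrite !inE eq_sym -EE cE mem_head.
pose dA i := 'D_1 (fun y => vertex_area E T (L y) i) 0.
have dAP i : is_derive (0 : R) 1 (fun y => vertex_area E T (L y) i) (dA i).
  apply: derivableP.
  have darea t : t \in T -> derivable (fun y => area E (L y) t) 0 1.
    by move=> tT; apply: derivable_area => //; rewrite area0.
  have dsum := @is_derive_bigsum R _ (index_enum _) (fun t => (t \in T) && (i \in t))
    (fun t y => area E (L y) t) _ 0 (fun t tTi => derivableP (darea t (andP tTi).1)).
  by have [] := is_deriveM dsum (is_derive_cst (3^-1 : R) (0 : R) (1 : R)).
(* The local areas add up to the total area. *)
have sum_dA : \sum_i dA i = 0.
  have dsum : is_derive (0 : R) 1 (fun y => total_area E T (L y)) (\sum_i dA i).
    under eq_fun do rewrite -(vertex_area_sum _ _ E) //.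
    exact: is_derive_bigsum.
  have dcst : is_derive (0 : R) 1 (fun y => total_area E T (L y)) 0.
    apply: near_eq_is_derive (is_derive_cst (total_area E T (L 0)) _ _).
    have := open_nbhs_nbhs (conj I_open I0).
    by apply: filterS => y Iy; rewrite area_const.
  by rewrite -(@derive_val _ _ _ _ _ _ _ dsum) (@derive_val _ _ _ _ _ _ _ dcst).
(* The local areas are absorbed in the weights. *)
pose w' y i j := (vertex_area E T (L y) i)^-1 * cot_weight T (L y) i j.
pose dw' i j := A^-1 * dw i j - b / A ^+ 2 * dA i.
have w'0 i j : i != j -> w' 0 i j = A^-1 * b by move=> ij; rewrite /w' vA w0.
have dw'P i j : i != j -> is_derive (0 : R) 1 (fun y => w' y i j) (dw' i j).
  move=> ij; have vA0 : vertex_area E T (L 0) i != 0 by rewrite vA gt_eqF.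
  have dV := @is_deriveV R (fun y => vertex_area E T (L y) i) 0 _ _ vA0 (dAP i).
  apply: is_derive_eq (is_deriveM dV (dwP i j)) _.
  by rewrite /dw' vA w0 // /GRing.scale /= -exprVn; ring.
have sum_dw' : \sum_i \sum_(j | j != i) dw' i j = 0.
  under eq_bigr do rewrite sumrB -mulr_sumr sumr_const cardC1.
  rewrite sumrB -mulr_sumr sum_dw mulr0 sub0r sumrMnl -mulr_sumr sum_dA.
  by rewrite mulr0 mul0rn oppr0.
have Ab0 : 0 < A^-1 * b by rewrite mulr_gt0 ?invr_gt0.
have := is_derive_ln_det'_laplace _ _ _ _ _ V0 Ab0 w'0 dw'P sum_dw'.
apply: near_eq_is_derive; apply: filterE => y; congr (ln (det' (operator_matrix _))).
apply/funext => f; apply/funext => i; rewrite /normalized_cot_laplace /cot_laplace.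
by rewrite edge_sum mulr_sumr; apply: eq_bigr => j _; rewrite mulrA.
Qed.
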